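(* For every integer $n\ge1$, the vertex-face walk on the toroidal $(4,n)$-grid admits peak state transfer. Specifically, for all $(i,j)\in\mathbb{Z}_4\times\mathbb{Z}_n$: (a) if $n$ is odd, there is peak state transfer from vertex $(i,j)$ to the vertices $(i\pm1,j)$ at time $n$; (b) if $n=2m$ for some integer $m$, there is peak state transfer from vertex $(i,j)$ to the vertices $(i\pm1,j+m)$ at time $m$; (c) if $n=4k$ for some integer $k$, there is peak state transfer from vertex $(i,j)$ to the vertices $(i\pm1,j\pm k)$ (all choices of signs) at time $k$.
   Context: Toroidal $(n,m)$-grid ($n,m\ge1$): the embedding of $C_n\square C_m$ in the torus (a multigraph with doubled edges or loops if $n$ or $m$ is $2$ or $1$). Concretely: the vertex set is $V=\mathbb{Z}_n\times\mathbb{Z}_m$; with $e_1=(1,0)$, $e_2=(0,1)$, the set $\mathcal{A}$ of arcs consists of the $4nm$ pairs $(x,s)$ with $x\in V$ and $s\in\{+e_1,-e_1,+e_2,-e_2\}$ (four formally distinct directions, even if $n$ or $m$ is $1$ or $2$), the arc $(x,s)$ having tail $x$ and head $x+s$. The face set is $F=\mathbb{Z}_n\times\mathbb{Z}_m$, where the arcs lying inside face $f$ are the four arcs $(f,+e_1)$, $(f+e_1,+e_2)$, $(f+e_1+e_2,-e_1)$, $(f+e_2,-e_2)$ (the boundary walk of the unit square with corner $f$); each arc lies inside exactly one face. Vertex-face walk: $N\in\mathbb{R}^{\mathcal{A}\times V}$ has $N(a,x)=\frac12$ if $x$ is the tail of $a$ and $0$ otherwise; $M\in\mathbb{R}^{\mathcal{A}\times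 F}$ has $M(a,f)=\frac12$ if $a$ lies inside $f$ and $0$ otherwise. The transition matrix is $U=(2MM^T-I)(2NN^T-I)$. Put $B_t=N^TU^tN$ for integers $t\ge0$ and $B=B_1$, a symmetric matrix with spectral decomposition $B=\sum_\theta\theta E_\theta$ ($\theta$ over distinct eigenvalues, $E_\theta$ the orthogonal projection onto the $\theta$-eigenspace). For distinct vertices $x,y$ there is peak state transfer from $x$ to $y$ at time $t$ (a positive integer) if $|B_t(x,y)|=\sum_\theta|E_\theta(x,y)|$ and $E_\theta(x,y)\neq0$ for at least one $\theta$. *)

(* Defs.v *)
From HB Require Import structures.
From mathcomp Require Import all_boot all_order all_algebra.
From mathcomp Require Import all_classical all_reals.
Set Implicit Arguments.
Unset Strict Implicit.
Unset Printing Implicit Defensive.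
Import Order.TTheory GRing.Theory Num.Theory.
Local Open Scope classical_set_scope.
Local Open Scope ring_scope.

(* Matrices whose rows and columns are indexed by finite types, through the
   enumerations of these types. *)
Definition ftmx (R : Type) (S T : finType) (F : S -> T -> R) :
    'M[R]_(#|S|, #|T|) :=
  \matrix_(i, j) F (enum_val i) (enum_val j).

Definition ftentry (R : Type) (S T : finType) (A : 'M[R]_(#|S|, #|T|))
    (x : S) (y : T) : R :=
  A (enum_rank x) (enum_rank y).

(* An inductive type, so that the four directions are distinct even when
   n or m is 1 or 2. *)
Inductive direction := PlusE1 | MinusE1 | PlusE2 | MinusE2.

Definition direction_encode (s : direction) : bool * bool :=
  match s with
  | PlusE1 => (false, false) | MinusE1 => (false, true)
  | PlusE2 => (true, false) | MinusE2 => (true, true)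
  end.

Definition direction_decode (b : bool * bool) : direction :=
  match b with
  | (false, false) => PlusE1 | (false, true) => MinusE1
  | (true, false) => PlusE2 | (true, true) => MinusE2
  end.

Lemma direction_encodeK : cancel direction_encode direction_decode.
Proof. by case. Qed.

HB.instance Definition _ :=
  Finite.copy direction (can_type direction_encodeK).

(* Z_n is represented by 'I_n with its cyclic successor [ordS] and cyclic
   predecessor [ord_pred]; unlike 'Z_n, this has n elements for n = 1 too. *)
Definition vertex (n m : nat) : finType := ('I_n * 'I_m)%type.
Definition face (n m : nat) : finType := ('I_n * 'I_m)%type.
Definition arc (n m : nat) : finType := (vertex n m * direction)%type.

Definition shift (n m : nat) (x : vertex n m) (s : direction) : vertex n m :=
  match s with
  | PlusE1 => (ordS x.1, x.2)
  | MinusE1 => (ord_pred x.1, x.2)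
  | PlusE2 => (x.1, ordS x.2)
  | MinusE2 => (x.1, ord_pred x.2)
  end.

Definition tail (n m : nat) (a : arc n m) : vertex n m := a.1.

Definition face_arcs (n m : nat) (f : face n m) : seq (arc n m) :=
  [:: (f, PlusE1); (shift f PlusE1, PlusE2);
      (shift (shift f PlusE1) PlusE2, MinusE1); (shift f PlusE2, MinusE2)].

Section VertexFaceWalk.
Variables (R : realType) (n m : nat).

Definition Nmx : 'M[R]_(#|arc n m|, #|vertex n m|) :=
  ftmx (fun (a : arc n m) (x : vertex n m) => if tail a == x then 2^-1 else 0).

Definition Mmx : 'M[R]_(#|arc n m|, #|face n m|) :=
  ftmx (fun (a : arc n m) (f : face n m) =>
          if a \in face_arcs f then 2^-1 else 0).

Definition Umx : 'M[R]_(#|arc n m|) :=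
  (2 *: (Mmx *m Mmx^T) - 1%:M) *m (2 *: (Nmx *m Nmx^T) - 1%:M).

Definition Bt (t : nat) : 'M[R]_(#|vertex n m|) := Nmx^T *m Umx ^+ t *m Nmx.

Definition Bmx : 'M[R]_(#|vertex n m|) := Bt 1.

End VertexFaceWalk.

(* The rows of [kermx W^T] span the orthogonal complement of the row space W,
   so this is the matrix of the projection onto W parallel to it. *)
Definition orthoproj (R : realType) (k : nat) (W : 'M[R]_k) : 'M[R]_k :=
  proj_mx W (kermx W^T).

(* [eigenspace] consists of row vectors; this is immaterial for a symmetric
   matrix such as [Bmx]. *)
Definition eigenproj (R : realType) (k : nat) (A : 'M[R]_k) (theta : R) :
    'M[R]_k :=
  orthoproj (eigenspace A theta).

(* The sum ranges over the finite set of distinct eigenvalues. *)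
Definition peak_state_transfer (R : realType) (n m : nat) (x y : vertex n m)
    (t : nat) : Prop :=
  [/\ x != y, (0 < t)%N,
      `|ftentry (Bt R n m t) x y| =
        \sum_(theta \in [set theta | eigenvalue (Bmx R n m) theta])
          `|ftentry (eigenproj (Bmx R n m) theta) x y|
    & exists theta : R, eigenvalue (Bmx R n m) theta /\
        ftentry (eigenproj (Bmx R n m) theta) x y != 0].

(* Main.v *)
From mathcomp Require Import all_boot all_order all_algebra.
From mathcomp Require Import all_classical all_reals.
From mathcomp Require Import trigo.
From mathcomp Require Import ring.
Require Import Defs.
Set Implicit Arguments.
Unset Strict Implicit.
Unset Printing Implicit Defensive.
Import Order.TTheory GRing.Theory Num.Theory.
Local Open Scope ring_scope.

(** Write [S1], [S2] for the cyclic shifts of the two factors of the grid and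
    [B_t = N^T U^t N]. The columns of [N] and of [M] are orthonormal, so [U] is
    a product of two reflections. As the second one fixes [N], the sum
    [U + U^-1] maps [N] to [2 N B], hence [B_(t+2) = 2 B_(t+1) B - B_t] and
    [B_t = T_t(B)], where [T_t] is the Chebyshev polynomial
    ([two_reflections_rec], [Bt_chebyshev]). Moreover
    [B = (2 + S1 + S1^-1) (2 + S2 + S2^-1) / 8 - 1] ([Bmx_mul]), so [B] is
    diagonalized by products of waves on the two cycles. On the cycle of
    length 4 the operator [S1 + S1^-1] has the eigenvalues 2, 0, -2, and the
    entry of its 0-idempotent at two adjacent points vanishes. On the cycle of
    length [n] put [w_b = 2 pi b / n]; then the eigenvalues of [B] are
      - [cos w_b], from the eigenvalue 2,
      - [(cos w_b - 1) / 2], from 0, which does not contribute to the entry of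
        an idempotent at [(i, j)] and [(i', j')] when [i], [i'] are adjacent,
      - [-1], from -2, which contributes [- 1/4] if [j = j'] and nothing
        otherwise.

    The entry of the wave [b] at [(j, j')] is a positive multiple of the cosine
    of a phase difference. Suppose that this cosine is [cos (t w_b)] for all
    [b], and that [4 t] is a multiple of [n], so that it is [-1], [0] or [1].
    Since [T_t(cos w) = cos (t w)], the product of [T_t(cos w_b)] with the entry
    is then the absolute value of the entry. If [j = j'] and [t] is odd, the
    sign of [T_t(-1) = (-1)^t] agrees with that of [- 1/4]. Thus [T_t(theta)] times the
    entry of [E_theta] is the absolute value of that entry, for every [theta],
    and summing over [theta] gives peak state transfer ([peak_torus4]). The
    three families of the theorem are the pairs [j], [j'] at distance [0],
    [n / 2] and [n / 4], with [t = n], [n / 2] and [n / 4].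

    The idempotents [E_theta] are never computed as projections: a resolution
    of the identity into symmetric eigenmatrices of [B], possibly with repeated
    eigenvalues, determines them ([eigenprojE]). This allows the real waves
    [cos (w_b (j - j')) / n], in which [b] and [n - b] give the same matrix. *)

(** * Matrices indexed by finite types *)

Section FtMatrix.
Variable R : pzRingType.
Implicit Types S T W : finType.

Lemma ftentryE S T (F : S -> T -> R) x y : ftentry (ftmx F) x y = F x y.
Proof. by rewrite /ftentry mxE !enum_rankK. Qed.

Lemma eq_ftmx S T (F G : S -> T -> R) : F =2 G -> ftmx F = ftmx G.
Proof. by move=> FG; apply/matrixP => i j; rewrite !mxE FG. Qed.

Lemma tr_ftmx S T (F : S -> T -> R) : (ftmx F)^T = ftmx (fun y x => F x y).
Proof. by apply/matrixP => i j; rewrite !mxE. Qed.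

Lemma mul_ftmx S T W (F : S -> T -> R) (G : T -> W -> R) :
  ftmx F *m ftmx G = ftmx (fun x z => \sum_y F x y * G y z).
Proof.
apply/matrixP => i j; rewrite !mxE (reindex_onto (@enum_rank T) enum_val) /=.
  by apply: eq_big => [y|y _]; rewrite ?enum_rankK ?eqxx // !mxE enum_rankK.
by move=> k _; rewrite enum_valK.
Qed.

Lemma ftmx1 T : ftmx (fun x y : T => (x == y)%:R) = 1%:M :> 'M[R]_#|T|.
Proof. by apply/matrixP => i j; rewrite !mxE (inj_eq enum_val_inj). Qed.

Lemma sum_ftmx (I : finType) S T (F : I -> S -> T -> R) :
  \sum_i ftmx (F i) = ftmx (fun x y => \sum_i F i x y).
Proof.
by apply/matrixP => i j; rewrite summxE mxE; apply: eq_bigr => k _; rewrite mxE.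
Qed.

End FtMatrix.

(** * Powers of a product of two reflections *)

Section TwoReflections.
Variables (R : comPzRingType) (a v f : nat).
Variables (N : 'M[R]_(a, v)) (M : 'M[R]_(a, f)).
Hypotheses (NtN : N^T *m N = 1%:M) (MtM : M^T *m M = 1%:M).

Lemma reflection_sqr k (K : 'M[R]_(a, k)) : K^T *m K = 1%:M ->
  (2 *: (K *m K^T) - 1%:M) *m (2 *: (K *m K^T) - 1%:M) = 1%:M.
Proof.
move=> KtK; rewrite mulmxBl mul1mx mulmxBr mulmx1 -scalemxAl -scalemxAr.
rewrite mulmxA -(mulmxA K) KtK mulmx1 scalerA opprB addrACA.
apply/matrixP=> i j; rewrite !mxE; ring.
Qed.

Let Q := 2 *: (M *m M^T) - 1%:M.
Let P := 2 *: (N *m N^T) - 1%:M.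
Let U := Q *m P.

Lemma mul_two_reflections : U *m N = Q *m N.
Proof.
have PN : P *m N = N.
  by rewrite mulmxBl mul1mx -scalemxAl -mulmxA NtN mulmx1 scaler_nat mulr2n addrK.
by rewrite /U -mulmxA PN.
Qed.

Lemma two_reflections_step :
  N^T *m U *m N = 2 *: ((M^T *m N)^T *m (M^T *m N)) - 1%:M.
Proof.
rewrite -mulmxA mul_two_reflections mulmxBl mul1mx mulmxBr NtN trmx_mul trmxK.
by rewrite -scalemxAl -scalemxAr !mulmxA.
Qed.

(** The Chebyshev recurrence for the compressed powers of [U]. As [P] fixes [N],
    one has [U N = Q N] and [U^-1 N = P Q N], hence
    [(U + U^-1) N = (1 + P) Q N = 2 N (N^T Q N)]. *)
Lemma two_reflections_rec t :
  N^T *m U ^+ t.+2 *m N =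
  2 *: ((N^T *m U ^+ t.+1 *m N) *m (N^T *m U *m N)) - N^T *m U ^+ t *m N.
Proof.
have UPQ : U *m (P *m Q) = 1%:M.
  by rewrite /U mulmxA -(mulmxA Q) reflection_sqr // mulmx1 reflection_sqr.
have UtN : U ^+ t *m N = U ^+ t.+1 *m (P *m Q *m N).
  by rewrite mulmxA exprSr -mulmxE -(mulmxA (U ^+ t)) UPQ mulmx1.
have BE : N^T *m U *m N = N^T *m (Q *m N) by rewrite -mulmxA mul_two_reflections.
have StN : U ^+ t.+2 *m N = U ^+ t.+1 *m (Q *m N).
  by rewrite exprSr -mulmxE -(mulmxA (U ^+ t.+1)) mul_two_reflections.
rewrite BE -(mulmxA N^T (U ^+ t.+2)) StN -(mulmxA N^T (U ^+ t)) UtN.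
rewrite -(mulmxA N^T (U ^+ t.+1)) -(mulmxA N^T) -(mulmxA (U ^+ t.+1)).
apply/esym/eqP; rewrite subr_eq; apply/eqP.
rewrite -mulmxDr -mulmxDr scalemxAr scalemxAr; congr (_ *m (_ *m _)).
rewrite -(mulmxA P) -[X in _ = X + _]mul1mx -mulmxDl /P addrCA subrr addr0.
by rewrite -scalemxAl !mulmxA.
Qed.

End TwoReflections.

(** * Spectral idempotents of a symmetric matrix *)

Section SpectralResolution.
Variables (R : realType) (k : nat).

(** A vector orthogonal to itself is null over the reals. *)
Lemma cap_orthocomplement (W : 'M[R]_k) : (W :&: kermx W^T = 0)%MS.
Proof.
apply/eqP; rewrite -submx0; apply/rV_subP => x; rewrite sub_capmx.
case/andP => /submxP[D ->] /sub_kermxP DWW; rewrite submx0.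
have /matrixP/(_ 0 0) : (D *m W) *m (D *m W)^T = 0.
  by rewrite trmx_mul mulmxA DWW mul0mx.
rewrite !mxE => /eqP; under eq_bigr do rewrite [X in _ * X]mxE -expr2.
rewrite psumr_eq0 => [/allP h|i _]; last exact: sqr_ge0.
apply/eqP/rowP => i; rewrite [RHS]mxE.
by apply/eqP; rewrite -sqrf_eq0; apply: h; rewrite mem_index_enum.
Qed.

Variables (A : 'M[R]_k) (I : finType) (P : I -> 'M[R]_k) (lam : I -> R).
Hypotheses (symA : A^T = A) (symP : forall i, (P i)^T = P i).
Hypotheses (AP : forall i, A *m P i = lam i *: P i) (sumP : \sum_i P i = 1%:M).

Lemma eigenmx_mulr i : P i *m A = lam i *: P i.
Proof. by apply: trmx_inj; rewrite trmx_mul linearZ /= symA symP AP. Qed.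

(** A symmetric resolution of the identity into eigenmatrices of [A] computes
    the spectral idempotents of [A], even when the matrices [P i] are not
    themselves idempotent and several of them share an eigenvalue. *)
Lemma eigenprojE theta : eigenproj A theta = \sum_(i | lam i == theta) P i.
Proof.
rewrite /eigenproj /orthoproj; set W := eigenspace A theta.
have WA : W *m A = theta *: W by apply/eigenspaceP.
have Pproj i : P i *m proj_mx W (kermx W^T) = if lam i == theta then P i else 0.
  case: eqP => [lth|/eqP lth].
    apply: proj_mx_id; first exact: cap_orthocomplement.
    by apply/eigenspaceP; rewrite eigenmx_mulr lth.
  apply: proj_mx_0; first exact: cap_orthocomplement.
  apply/sub_kermxP/eqP.
  have : theta *: (P i *m W^T) = lam i *: (P i *m W^T).
    by rewrite scalemxAr -linearZ /= -WA trmx_mul symA mulmxA eigenmx_mulr scalemxAl.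
  move/eqP; rewrite -subr_eq0 -scalerBl scaler_eq0 subr_eq0 eq_sym.
  by rewrite (negPf lth).
rewrite -[LHS]mul1mx -sumP mulmx_suml [RHS]big_mkcond.
by apply: eq_bigr => i _; exact: Pproj.
Qed.

Lemma eigenproj0 theta : ~~ eigenvalue A theta -> eigenproj A theta = 0.
Proof.
rewrite /eigenvalue negbK /eigenproj /orthoproj => /eqP ->.
by apply/eqP; rewrite -submx0 -[proj_mx _ _]mul1mx proj_mx_sub.
Qed.

(** From here on [C] plays the role of [c(A)], and the value of [c] at each
    eigenvalue compensates the sign of the entry at [(u, v)] of the
    corresponding matrix [P i]. *)
Variables (C : 'M[R]_k) (c : R -> R) (u v : 'I_k).
Hypotheses (CP : forall i, C *m P i = c (lam i) *: P i).
Hypothesis sgnP : forall i, c (lam i) * P i u v = `|P i u v|.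

(** The matrices [P i] that share an eigenvalue do not cancel at [(u, v)]: if
    one of these entries is nonzero, then [c theta] is [1] or [-1] and all of
    them have its sign. *)
Lemma norm_eigenproj theta :
  `|eigenproj A theta u v| = \sum_(i | lam i == theta) `|P i u v|.
Proof.
rewrite eigenprojE summxE.
have cE : c theta * \sum_(i | lam i == theta) P i u v =
          \sum_(i | lam i == theta) `|P i u v|.
  by rewrite mulr_sumr; apply: eq_bigr => i /eqP <-.
have [[i /andP[/eqP li Pi0]]|none] :=
    pselect (exists i, (lam i == theta) && (P i u v != 0)).
  rewrite -cE -[RHS]ger0_norm ?normrM; last first.
    by rewrite cE sumr_ge0.
  suff -> : `|c theta| = 1 by rewrite mul1r.
  have := congr1 (fun z => `|z|) (sgnP i); rewrite normrM normr_id li.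
  by rewrite -[RHS]mul1r => /mulIf; apply; rewrite normr_eq0.
have P0 i : lam i == theta -> P i u v = 0.
  by move=> li; apply/eqP/negP => /negP Pi; apply: none; exists i; rewrite li.
by rewrite !big1 ?normr0 // => i li; rewrite P0 ?normr0.
Qed.

(** The entry [C u v] is as large as the spectral decomposition of [A]
    permits for a matrix [c(A)] with [`|c| <= 1]. *)
Lemma entry_eq_sum_eigenproj :
  `|C u v| =
  \sum_(theta \in [set theta | eigenvalue A theta]%classic)
    `|eigenproj A theta u v|.
Proof.
have -> : C u v = \sum_i `|P i u v|.
  rewrite -[C]mulmx1 -sumP mulmx_sumr summxE; apply: eq_bigr => i _.
  by rewrite CP mxE sgnP.
rewrite ger0_norm ?sumr_ge0 //.
pose s := undup [seq lam i | i <- enum I].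
have lams i : lam i \in s by rewrite mem_undup map_f ?mem_enum.
rewrite (fsbig_fwiden s).
(* All the [lam i] are listed in [s], whether or not they are eigenvalues:
   [P i] may be null. *)
- under [RHS]eq_bigr do rewrite norm_eigenproj big_mkcond.
  rewrite exchange_big /=; apply: eq_bigr => i _.
  rewrite -big_mkcond (eq_bigl (pred1 (lam i))) => [|theta]; last exact: eq_sym.
  by rewrite -big_filter filter_pred1_uniq ?undup_uniq // big_seq1.
- move=> theta /= th; have [//|thN] := boolP (theta \in s); exfalso.
  case/negP: th; have := proj_mx_id (cap_orthocomplement (eigenspace A theta)) (submx_refl _).
  rewrite -[proj_mx _ _]/(eigenproj A theta) eigenprojE big1 ?mulmx0 => [-> //|].
  by move=> i /eqP li; rewrite -li lams in thN.
- exact: undup_uniq.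
- by move=> theta [_ /= /negP th]; rewrite eigenproj0 // mxE normr0.
Qed.

Lemma eigenproj_entry_neq0 i : P i u v != 0 ->
  eigenvalue A (lam i) /\ eigenproj A (lam i) u v != 0.
Proof.
move=> Pi.
have E0 : eigenproj A (lam i) u v != 0.
  rewrite -normr_gt0 norm_eigenproj (bigD1 i) //= ltr_pwDl ?normr_gt0 //.
  by rewrite sumr_ge0.
split=> //; apply: contraNT E0 => /eigenproj0 ->; by rewrite mxE.
Qed.

End SpectralResolution.

(** * Cosine waves on a cycle *)

Section CycleWaves.
Variable R : realType.

(** The angular frequency [2 pi b / n] of the wave number [b] on the cycle of
    length [n]. *)
Definition freq (n b : nat) : R := 2 * pi * b%:R / n%:R.

Lemma cosD2pin (k : nat) (a : R) : cos (a + 2 * pi * k%:R) = cos a.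
Proof.
rewrite (_ : 2 * pi * k%:R = pi *+ 2 *+ k); first exact: (periodicn (@cosD2pi R)).
by rewrite mulr_natl mulr_natr.
Qed.

(** Multiplied by [2 sin h], with [h = pi d / n] half the angle from one term
    to the next, the sum telescopes. *)
Lemma sum_cos_freq (n d : nat) : (0 < d < n)%N ->
  \sum_(b < n) cos (freq n b * d%:R) = 0.
Proof.
case/andP=> d0 dn; have n0 : (0 < n%:R :> R) by rewrite ltr0n (ltn_trans d0).
have n0' := lt0r_neq0 n0.
pose h : R := pi * d%:R / n%:R.
have sh : 0 < sin h.
  apply: sin_gt0_pi; rewrite divr_gt0 //= ?mulr_gt0 ?pi_gt0 ?ltr0n //.
  by rewrite ltr_pdivrMr // ltr_pM2l ?pi_gt0 // ltr_nat.
apply: (mulfI (lt0r_neq0 sh)); rewrite mulr0; apply: (@mulfI R 2); first by rewrite pnatr_eq0.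
rewrite mulr0 !mulr_sumr.
rewrite -(big_mkord xpredT (fun b => 2 * (sin h * cos (freq n b * d%:R)))).
rewrite (telescope_sumr_eq (fun b => sin (2 * b%:R * h - h))) => [|//|b _].
  rewrite mulr0 mul0r (_ : 2 * n%:R * h - h = - h + 2 * pi * d%:R); last first.
    by rewrite /h; field.
  by rewrite -cosBpihalf addrAC cosD2pin cosBpihalf sub0r subrr.
have -> : freq n b * d%:R = 2 * b%:R * h by rewrite /freq /h; field.
have -> : 2 * b.+1%:R * h - h = 2 * b%:R * h + h by rewrite -natr1; ring.
rewrite sinD sinB; ring.
Qed.

(** As far as cosines are concerned, a step around the cycle adds [freq n b] to
    the phase, including the step from [n - 1] to [0]. *)
Lemma cos_freq_ordS n b (x : 'I_n) c :
  cos (freq n b * (ordS x)%:R + c) = cos (freq n b * x%:R + (freq n b + c)).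
Proof.
have n0 : (n%:R != 0 :> R) by rewrite pnatr_eq0 -lt0n (leq_ltn_trans _ (ltn_ord x)).
rewrite -(cosD2pin (b * (x.+1 %/ n))); congr cos.
have := congr1 (fun k => k%:R : R) (divn_eq x.+1 n); rewrite natrD natrM -natr1 /=.
by rewrite /freq natrM => /(canRL (addrK _)) ->; field.
Qed.

Lemma cos_freq_ord_pred n b (x : 'I_n) c :
  cos (freq n b * (ord_pred x)%:R + c) = cos (freq n b * x%:R + (c - freq n b)).
Proof. by rewrite -{2}(ord_predK x) cos_freq_ordS; congr (cos (_ + _)); ring. Qed.

Lemma cos_freq_iter_ordS n b m (x : 'I_n) c :
  cos (freq n b * (iter m (@ordS n) x)%:R + c) =
  cos (freq n b * x%:R + (freq n b * m%:R + c)).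
Proof.
elim: m c => [|m IHm] c; first by rewrite mulr0 add0r.
by rewrite iterS cos_freq_ordS IHm; congr (cos (_ + _)); rewrite -natr1; ring.
Qed.

Lemma cos_freq_iter_ord_pred n b m (x : 'I_n) c :
  cos (freq n b * (iter m (@ord_pred n) x)%:R + c) =
  cos (freq n b * x%:R + (c - freq n b * m%:R)).
Proof.
elim: m c => [|m IHm] c; first by rewrite mulr0 subr0.
by rewrite iterS cos_freq_ord_pred IHm; congr (cos (_ + _)); rewrite -natr1; ring.
Qed.

(** The real symmetric eigenmatrix of the cycle of length [n] for the wave
    number [b]. It coincides with the one for [n - b], so that it is an
    idempotent or half an idempotent. *)
Definition wave n (b : nat) (x y : 'I_n) : R :=
  n%:R^-1 * cos (freq n b * x%:R - freq n b * y%:R).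

Lemma waveC n b (x y : 'I_n) : wave b x y = wave b y x.
Proof. by rewrite /wave -cosN opprB. Qed.

Lemma wave_neighbours n b (x y : 'I_n) :
  wave b (ordS x) y + wave b (ord_pred x) y = 2 * cos (freq n b) * wave b x y.
Proof.
rewrite /wave cos_freq_ordS cos_freq_ord_pred.
set w := freq n b; set p := w * x%:R; set q := w * y%:R.
have -> : p + (w - q) = p - q + w by ring.
have -> : p + (- q - w) = p - q - w by ring.
set d := p - q; rewrite cosD (cosB d); ring.
Qed.

Lemma sum_wave n (x y : 'I_n) : \sum_(b < n) wave b x y = (x == y)%:R.
Proof.
have n0 : (0 < n)%N by rewrite (leq_ltn_trans _ (ltn_ord x)).
wlog xy : x y / (y <= x)%N.
  move=> th; have /orP[|/th //] := leq_total x y.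
  by move/th; rewrite eq_sym => <-; apply: eq_bigr => b _; exact: waveC.
rewrite -mulr_sumr.
under eq_bigr do rewrite -mulrBr -natrB //.
have [->|xNy] := eqVneq x y.
  under eq_bigr do rewrite subnn mulr0 cos0.
  by rewrite sumr_const card_ord mulVf // pnatr_eq0 -lt0n.
have yx : (y < x)%N by rewrite ltn_neqAle xy andbT eq_sym.
by rewrite sum_cos_freq ?mulr0 // subn_gt0 yx (leq_ltn_trans (leq_subr _ _)).
Qed.

End CycleWaves.

(** * Chebyshev polynomials of the first kind *)

(** The value at [x] of the polynomial of degree [t]. *)
Fixpoint chebyshev (R : pzRingType) (t : nat) (x : R) : R :=
  match t with
  | 0 => 1
  | 1 => x
  | (t'.+1 as t1).+1 => 2 * x * chebyshev t1 x - chebyshev t' x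
  end.

Lemma chebyshevSS (R : pzRingType) t (x : R) :
  chebyshev t.+2 x = 2 * x * chebyshev t.+1 x - chebyshev t x.
Proof. by []. Qed.

Lemma nat_ind2 (Q : nat -> Prop) :
  Q 0 -> Q 1 -> (forall t, Q t -> Q t.+1 -> Q t.+2) -> forall t, Q t.
Proof.
move=> Q0 Q1 QSS t; suff: Q t /\ Q t.+1 by case.
by elim: t => [//|t [Qt QSt]]; split=> //; exact: QSS.
Qed.

Lemma chebyshev_cos (R : realType) t (x : R) : chebyshev t (cos x) = cos (t%:R * x).
Proof.
elim/nat_ind2: t => [||t IH0 IH1]; first by rewrite mul0r cos0.
  by rewrite mul1r.
rewrite chebyshevSS IH0 IH1.
have -> : t.+2%:R * x = t.+1%:R * x + x by rewrite -[t.+2%:R]natr1; ring.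
have -> : t%:R * x = t.+1%:R * x - x by rewrite -[t.+1%:R]natr1; ring.
rewrite cosB cosD; ring.
Qed.

Lemma chebyshevN1 (R : realType) t : chebyshev t (- 1 : R) = (- 1) ^+ t.
Proof.
elim/nat_ind2: t => [||t IH0 IH1] //; rewrite chebyshevSS IH0 IH1 !exprS; ring.
Qed.

(** * Incidence matrices of the toroidal grid *)

Section Grid.
Variables (R : realType) (n m : nat).
Implicit Types (x y f : vertex n m) (a : arc n m).
Local Notation N := (Nmx R n m).
Local Notation M := (Mmx R n m).

(** The unique face inside which an arc lies. *)
Definition face_of a : face n m :=
  match a.2 with
  | PlusE1 => a.1
  | PlusE2 => shift a.1 MinusE1
  | MinusE1 => shift (shift a.1 MinusE2) MinusE1
  | MinusE2 => shift a.1 MinusE2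
  end.

Lemma mem_face_arcs a f : (a \in face_arcs f) = (face_of a == f).
Proof.
case: a f => [[x1 x2] s] [f1 f2].
rewrite !inE !xpair_eqE /=.
have pS k (i j : 'I_k) : (ord_pred i == j) = (i == ordS j).
  exact: (can2_eq (@ord_predK k) (@ordSK k)).
by case: s; rewrite /face_of xpair_eqE /= ?pS ?andbT ?andbF ?orbF.
Qed.

(** The four arcs inside a face have distinct directions, hence are distinct
    even on the smallest grids. *)
Lemma uniq_face_arcs f : uniq (face_arcs f).
Proof. by rewrite /= !inE !xpair_eqE !andbF. Qed.

Lemma sum_direction (F : direction -> R) :
  \sum_s F s = F PlusE1 + F MinusE1 + F PlusE2 + F MinusE2.
Proof.
rewrite (reindex direction_decode) /=; last first.
  by exists direction_encode => [[[] []]|[]].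
rewrite (eq_bigr (fun p => F (direction_decode (p.1, p.2)))); last by case.
rewrite -(pair_bigA _ (fun b c => F (direction_decode (b, c)))) /= !big_bool /=.
ring.
Qed.

Lemma sum_tail (F : arc n m -> R) x :
  \sum_a (if tail a == x then 2^-1 else 0) * F a = 2^-1 * \sum_s F (x, s).
Proof.
rewrite (eq_bigr (fun a => if a.1 == x then 2^-1 * F (a.1, a.2) else 0)); last first.
  by move=> [y s] _; rewrite /tail /=; case: eqP => _; rewrite ?mul0r.
rewrite -(pair_bigA _ (fun y s => if y == x then 2^-1 * F (y, s) else 0)) /=.
rewrite (bigD1 x) //= [X in _ + X]big1 => [|y /negPf ->]; last exact: big1_eq.
by rewrite addr0 eqxx mulr_sumr.
Qed.

Lemma sum_face_arcs (F : arc n m -> R) f :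
  \sum_a (if a \in face_arcs f then 2^-1 else 0) * F a =
  2^-1 * \sum_(a <- face_arcs f) F a.
Proof.
rewrite mulr_sumr (big_uniq _ (uniq_face_arcs f)) [RHS]big_mkcond /=.
by apply: eq_bigr => a _; case: ifP => _ //; rewrite mul0r.
Qed.

Lemma Nmx_mul (T : finType) (G : vertex n m -> T -> R) :
  N *m ftmx G = ftmx (fun a z => 2^-1 * G (tail a) z).
Proof.
rewrite mul_ftmx; apply: eq_ftmx => a z; rewrite (bigD1 (tail a)) //= eqxx.
by rewrite big1 ?addr0 // => x xa; rewrite eq_sym (negPf xa) mul0r.
Qed.

Lemma Mmx_mul (T : finType) (G : face n m -> T -> R) :
  M *m ftmx G = ftmx (fun a z => 2^-1 * G (face_of a) z).
Proof.
rewrite mul_ftmx; apply: eq_ftmx => a z; rewrite (bigD1 (face_of a)) //=.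
rewrite mem_face_arcs eqxx.
by rewrite big1 ?addr0 // => x xa; rewrite mem_face_arcs eq_sym (negPf xa) mul0r.
Qed.

Lemma trNmx_mul (T : finType) (G : arc n m -> T -> R) :
  N^T *m ftmx G = ftmx (fun x z => 2^-1 * \sum_s G (x, s) z).
Proof.
by rewrite tr_ftmx mul_ftmx; apply: eq_ftmx => x z; rewrite sum_tail.
Qed.

Lemma trMmx_mul (T : finType) (G : arc n m -> T -> R) :
  M^T *m ftmx G = ftmx (fun f z => 2^-1 * \sum_(a <- face_arcs f) G a z).
Proof.
by rewrite tr_ftmx mul_ftmx; apply: eq_ftmx => x z; rewrite sum_face_arcs.
Qed.

Lemma Nmx_orthonormal : N^T *m N = 1%:M.
Proof.
rewrite trNmx_mul -ftmx1; apply: eq_ftmx => x y.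
by rewrite sum_direction /tail /=; case: eqP => _ /=; field.
Qed.

Lemma face_of_face_arcs f a : a \in face_arcs f -> face_of a = f.
Proof. by rewrite mem_face_arcs => /eqP. Qed.

Lemma Mmx_orthonormal : M^T *m M = 1%:M.
Proof.
rewrite trMmx_mul -ftmx1; apply: eq_ftmx => f g.
rewrite (eq_big_seq (fun=> if f == g then 2^-1 else 0)); last first.
  by move=> a /face_of_face_arcs af; rewrite mem_face_arcs af.
by rewrite !big_cons big_nil; case: eqP => _ /=; field.
Qed.

Lemma BmxE : Bmx R n m = 2 *: ((M^T *m N)^T *m (M^T *m N)) - 1%:M.
Proof.
by rewrite -(two_reflections_step M Nmx_orthonormal) /Bmx /Bt expr1.
Qed.

Lemma Bmx_sym : (Bmx R n m)^T = Bmx R n m.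
Proof. by rewrite BmxE linearB linearZ /= trmx_mul trmxK trmx1. Qed.

Lemma Bt_rec t : Bt R n m t.+2 = 2 *: (Bt R n m t.+1 *m Bmx R n m) - Bt R n m t.
Proof.
rewrite /Bmx /Bt expr1.
exact: (two_reflections_rec Nmx_orthonormal Mmx_orthonormal).
Qed.

Lemma Bt_chebyshev (k : nat) (P : 'M[R]_(_, k)) (l : R) :
  Bmx R n m *m P = l *: P -> forall t, Bt R n m t *m P = chebyshev t l *: P.
Proof.
move=> BP; elim/nat_ind2 => [||t IH0 IH1].
- by rewrite /Bt expr0 mulmx1 Nmx_orthonormal mul1mx scale1r.
- exact: BP.
rewrite Bt_rec chebyshevSS mulmxBl -scalemxAl -mulmxA BP -scalemxAr IH1 IH0.
by rewrite !scalerA scalerBl; congr (_ *: _ - _); ring.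
Qed.

(** [B = (2 + S1 + S1^-1) (2 + S2 + S2^-1) / 8 - 1], where [S1], [S2] are the
    cyclic shifts of the two factors, applied to a tensor product. *)
Lemma Bmx_mul (g : 'I_n -> 'I_n -> R) (h : 'I_m -> 'I_m -> R) :
  Bmx R n m *m ftmx (fun x y : vertex n m => g x.1 y.1 * h x.2 y.2) =
  ftmx (fun x y : vertex n m =>
    (2 * g x.1 y.1 + (g (ordS x.1) y.1 + g (ord_pred x.1) y.1)) *
    (2 * h x.2 y.2 + (h (ordS x.2) y.2 + h (ord_pred x.2) y.2)) / 8
    - g x.1 y.1 * h x.2 y.2).
Proof.
rewrite BmxE mulmxBl mul1mx -scalemxAl trmx_mul trmxK -!mulmxA.
rewrite Nmx_mul trMmx_mul Mmx_mul trNmx_mul; apply/matrixP => i j; rewrite !mxE.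
move: (enum_val i) (enum_val j) => [x1 x2] [y1 y2].
rewrite sum_direction /face_of !big_cons !big_nil /= /tail /= !ord_predK.
by field.
Qed.

End Grid.

(** * The toroidal (4,n)-grid *)

Lemma sin_pi_natmul (R : realType) (k : nat) : sin (pi * k%:R) = 0 :> R.
Proof.
elim: k => [|k IHk]; first by rewrite mulr0 sin0.
by rewrite -natr1 mulrDr mulr1 sinDpi IHk oppr0.
Qed.

Section Torus4.
Variables (R : realType) (n : nat) (n_gt0 : (0 < n)%N).
Implicit Types x y : vertex 4 n.

(** The idempotent of the cycle of length 4 for the eigenvalue [-2] of the
    neighbour sum [g (ordS i) + g (ord_pred i)]. *)
Definition sign4 (i j : 'I_4) : R := 4^-1 * (- 1) ^+ (i + j).

(** The idempotent of the cycle of length 4 for the eigenvalue [0] of the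
    neighbour sum; the constant matrix [4^-1] is the one for the eigenvalue
    [2]. *)
Definition null4 (i j : 'I_4) : R := (i == j)%:R - 4^-1 - sign4 i j.

Lemma sign4_neighbours i j : sign4 (ordS i) j + sign4 (ord_pred i) j = - 2 * sign4 i j.
Proof.
rewrite /sign4; case: i => [[|[|[|[|i]]]] //= lti]; case: j => [[|[|[|[|j]]]] //= ltj];
  rewrite ?exprS ?expr0; ring.
Qed.

Lemma null4_neighbours i j : null4 (ordS i) j + null4 (ord_pred i) j = 0.
Proof.
rewrite /null4 /sign4 -!val_eqE.
case: i => [[|[|[|[|i]]]] //= lti]; case: j => [[|[|[|[|j]]]] //= ltj];
  rewrite ?exprS ?expr0; by field.
Qed.

Lemma sign4C i j : sign4 i j = sign4 j i.
Proof. by rewrite /sign4 addnC. Qed.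

Lemma null4C i j : null4 i j = null4 j i.
Proof. by rewrite /null4 sign4C eq_sym. Qed.

Lemma sign4_adjacent (i i' : 'I_4) : i' \in [:: ordS i; ord_pred i] ->
  sign4 i i' = - 4^-1.
Proof.
rewrite /sign4 !inE -!val_eqE => adj.
suff -> : (- 1 : R) ^+ (i + i') = - 1 by rewrite mulrN1.
rewrite -signr_odd; suff -> : odd (i + i') by rewrite expr1.
by move: adj; case: i => [[|[|[|[|i]]]] //= lti]; case: i' => [[|[|[|[|j]]]] //= ltj].
Qed.

Lemma adjacent_neq (i i' : 'I_4) : i' \in [:: ordS i; ord_pred i] -> i != i'.
Proof.
rewrite !inE -!val_eqE => adj.
by move: adj; case: i => [[|[|[|[|i]]]] //= lti]; case: i' => [[|[|[|[|j]]]] //= ltj].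
Qed.

(** The indices of a resolution of the identity into symmetric eigenmatrices of
    [B]: the idempotents for [2] and for [0] on the cycle of length 4 are
    combined with each wave on the other cycle. All the products of [sign4] with
    a wave have the eigenvalue [-1]; they are gathered in a single matrix,
    because their entries can have opposite signs. *)
Definition torus_index : finType := ('I_n + 'I_n + unit)%type.

(** Row and column indices are vertices; [torus_eigenvalue] below gives the
    eigenvalue of [B] on each of these matrices. *)
Definition torus_entry (k : torus_index) x y : R :=
  match k with
  | inl (inl b) => 4^-1 * wave R b x.2 y.2
  | inl (inr b) => null4 x.1 y.1 * wave R b x.2 y.2
  | inr tt => sign4 x.1 y.1 * (x.2 == y.2)%:R
  end.

Definition torus_mx k := ftmx (torus_entry k).

Definition torus_eigenvalue (k : torus_index) : R :=
  match k with
  | inl (inl b) => cos (freq R n b)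
  | inl (inr b) => (cos (freq R n b) - 1) / 2
  | inr tt => - 1
  end.

Lemma torus_mx_sym k : (torus_mx k)^T = torus_mx k.
Proof.
rewrite tr_ftmx; apply: eq_ftmx => x y; rewrite /torus_entry.
by case: k => [[]b|[]]; rewrite 1?waveC 1?null4C 1?sign4C 1?eq_sym.
Qed.

Lemma torus_mx_eigen k :
  Bmx R 4 n *m torus_mx k = torus_eigenvalue k *: torus_mx k.
Proof.
rewrite /torus_mx.
have scE F : torus_eigenvalue k *: ftmx F =
    ftmx (fun x y : vertex 4 n => torus_eigenvalue k * F x y).
  by apply/matrixP => i j; rewrite !mxE.
rewrite scE; case: k {scE} => [[]b|[]] /=.
- rewrite (Bmx_mul (fun _ _ => 4^-1) (wave R b)); apply: eq_ftmx => x y.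
  by rewrite wave_neighbours; field.
- rewrite (Bmx_mul null4 (wave R b)); apply: eq_ftmx => x y.
  by rewrite wave_neighbours null4_neighbours; field.
- rewrite (Bmx_mul sign4 (fun i j => (i == j)%:R)); apply: eq_ftmx => x y.
  by rewrite sign4_neighbours; field.
Qed.

Lemma sum_torus_mx : \sum_k torus_mx k = 1%:M.
Proof.
rewrite sum_ftmx -ftmx1; apply: eq_ftmx => x y; rewrite !big_sumType /=.
rewrite -mulr_sumr sum_wave -mulr_sumr sum_wave (big_pred1 tt) => [|[]//] /=.
rewrite -!mulrDl /null4 -[x == y]/((x.1 == y.1) && (x.2 == y.2)) -mulnb natrM.
by congr (_ * _); ring.
Qed.

(** The phase difference of [x] and [y] along the cycle of length [n] has to
    match the angle [t w_b] of the Chebyshev polynomial [T_t] at [cos w_b].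
    Divisibility makes this angle a multiple of [pi / 2]. The parity condition
    matches [T_t(-1) = (-1)^t] with the negative entry of [sign4], which is
    present only if [x] and [y] agree in the second coordinate. *)
Lemma peak_torus4 x y t :
  y.1 \in [:: ordS x.1; ord_pred x.1] -> (0 < t)%N ->
  (forall b, cos (freq R n b * x.2%:R - freq R n b * y.2%:R) =
             cos (t%:R * freq R n b)) ->
  (n %| 4 * t)%N -> (x.2 = y.2 -> odd t) ->
  peak_state_transfer R x y t.
Proof.
move=> adj t0 phase /dvdnP[q qE] oddt.
have n0 : n%:R != 0 :> R by rewrite pnatr_eq0 -lt0n.
have null0 : null4 x.1 y.1 = 0.
  by rewrite /null4 (negPf (adjacent_neq adj)) sign4_adjacent //=; ring.
have norm_sqr b : `|cos (t%:R * freq R n b)| = cos (t%:R * freq R n b) ^+ 2.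
  set z := _ * _.
  have s2 : sin (z *+ 2) = 0.
    have -> : z *+ 2 = pi * (q * b)%:R.
      have tE : t%:R = q%:R * n%:R / 4 :> R.
        have four : 4 != 0 :> R by rewrite pnatr_eq0.
        by apply: (mulIf four); rewrite divfK // -!natrM -qE mulnC.
      by rewrite /z /freq tE natrM -mulr_natl; field.
    exact: sin_pi_natmul.
  move: s2; rewrite sin_mulr2n => /eqP; rewrite mulrn_eq0 mulf_eq0 /=.
  case/orP => /eqP z0; first by rewrite z0 normr0 expr0n.
  by rewrite -real_normK ?num_real // sin0cos1 // expr1n.
pose u := enum_rank x; pose v := enum_rank y.
have PE k : torus_mx k u v = torus_entry k x y by rewrite -[LHS]/(ftentry _ x y) ftentryE.
have sgnP k : chebyshev t (torus_eigenvalue k) * torus_mx k u v = `|torus_mx k u v|.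
  rewrite PE; case: k => [[]b|[]] /=.
  - rewrite chebyshev_cos /wave phase !normrM norm_sqr !ger0_norm ?invr_ge0 ?ler0n //.
    ring.
  - by rewrite null0 mul0r mulr0 normr0.
  - rewrite chebyshevN1 sign4_adjacent //; case: eqP => [/oddt ot|_].
      rewrite -signr_odd ot !mulr1 normrN ger0_norm ?invr_ge0 ?ler0n //; ring.
    by rewrite !mulr0 normr0.
have BtP k : Bt R 4 n t *m torus_mx k = chebyshev t (torus_eigenvalue k) *: torus_mx k.
  by apply: Bt_chebyshev; exact: torus_mx_eigen.
split=> //.
- by apply: contraNneq (adjacent_neq adj) => ->.
- exact: (entry_eq_sum_eigenproj (Bmx_sym R 4 n) torus_mx_sym torus_mx_eigen
            sum_torus_mx BtP sgnP).
(* The constant eigenvectors, with eigenvalue 1, give a nonzero entry. *)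
- pose k0 : torus_index := inl (inl (Ordinal n_gt0)).
  exists (torus_eigenvalue k0).
  apply: (eigenproj_entry_neq0 (Bmx_sym R 4 n) torus_mx_sym torus_mx_eigen
            sum_torus_mx sgnP).
  rewrite PE /= /wave phase /freq mulr0 mul0r mulr0 cos0 mulr1.
  by rewrite mulf_neq0 ?invr_eq0 ?n0 ?pnatr_eq0.
Qed.

Lemma iter_ordS_phase (j : 'I_n) t b :
  cos (freq R n b * j%:R - freq R n b * (iter t (@ordS n) j)%:R) =
  cos (t%:R * freq R n b).
Proof. by rewrite -cosN opprB cos_freq_iter_ordS; congr cos; ring. Qed.

Lemma iter_ord_pred_phase (j : 'I_n) t b :
  cos (freq R n b * j%:R - freq R n b * (iter t (@ord_pred n) j)%:R) =
  cos (t%:R * freq R n b).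
Proof.
by rewrite -cosN opprB cos_freq_iter_ord_pred -[RHS]cosN; congr cos; ring.
Qed.

(** The wave number 1 separates two points as soon as the cosine of their phase
    difference is not 1. *)
Lemma phase_neq (j j' : 'I_n) t :
  cos (freq R n 1 * j%:R - freq R n 1 * j'%:R) = cos (t%:R * freq R n 1) ->
  cos (t%:R * freq R n 1) != 1 -> j != j'.
Proof. by move=> ph; apply: contraNneq => jj; rewrite -ph jj subrr cos0. Qed.

Lemma peak_odd (i i' : 'I_4) (j : 'I_n) :
  odd n -> i' \in [:: ordS i; ord_pred i] ->
  peak_state_transfer R ((i, j) : vertex 4 n) (i', j) n.
Proof.
move=> on adj; apply: peak_torus4 => //= [b|]; last exact: dvdn_mull.
rewrite subrr (_ : n%:R * _ = 0 + 2 * pi * b%:R) ?cosD2pin //.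
by rewrite /freq add0r mulrC divfK // pnatr_eq0 -lt0n.
Qed.

Lemma peak_half (m : nat) (i i' : 'I_4) (j : 'I_n) :
  n = (2 * m)%N -> i' \in [:: ordS i; ord_pred i] ->
  peak_state_transfer R ((i, j) : vertex 4 n) (i', iter m (@ordS n) j) m.
Proof.
move=> nE adj; have m0 : (0 < m)%N by move: n_gt0; rewrite nE; case: (m).
apply: peak_torus4 => //= [b||jj]; first exact: iter_ordS_phase.
  by rewrite nE dvdn_mul.
have := phase_neq (iter_ordS_phase j m 1); rewrite -jj eqxx.
have -> : m%:R * freq R n 1 = pi.
  by rewrite /freq nE natrM; field; rewrite pnatr_eq0 -lt0n.
suff -> : cos pi != 1 :> R by move/(_ isT).
by rewrite cospi lt_eqF // (lt_trans (ltrN10 R) ltr01).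
Qed.

Lemma peak_quarter (k : nat) (i i' : 'I_4) (j j' : 'I_n) :
  n = (4 * k)%N -> i' \in [:: ordS i; ord_pred i] ->
  j' \in [:: iter k (@ordS n) j; iter k (@ord_pred n) j] ->
  peak_state_transfer R ((i, j) : vertex 4 n) (i', j') k.
Proof.
move=> nE adj jj; have k0 : (0 < k)%N by move: n_gt0; rewrite nE; case: (k).
have phase b : cos (freq R n b * j%:R - freq R n b * j'%:R) =
               cos (k%:R * freq R n b).
  move: jj; rewrite !inE => /orP[]/eqP ->; first exact: iter_ordS_phase.
  exact: iter_ord_pred_phase.
apply: peak_torus4 => //= [|je]; first by rewrite -nE.
have := phase_neq (phase 1); rewrite je eqxx.
have -> : k%:R * freq R n 1 = pi / 2.
  by rewrite /freq nE natrM; field; rewrite pnatr_eq0 -lt0n.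
by rewrite cos_pihalf eq_sym oner_eq0 => /(_ isT).
Qed.

End Torus4.

Theorem theorem6p7 (R : realType) (n : nat) (hn : (1 <= n)%N) :
  (exists (x y : vertex 4 n) (t : nat), peak_state_transfer R x y t) /\
  forall (i : 'I_4) (j : 'I_n),
    [/\ odd n ->
          forall i' : 'I_4, i' \in [:: ordS i; ord_pred i] ->
          peak_state_transfer R ((i, j) : vertex 4 n) (i', j) n,
        forall m : nat, n = (2 * m)%N ->
          forall i' : 'I_4, i' \in [:: ordS i; ord_pred i] ->
          peak_state_transfer R ((i, j) : vertex 4 n)
            (i', iter m (@ordS n) j) m
      & forall k : nat, n = (4 * k)%N ->
          forall (i' : 'I_4) (j' : 'I_n),
          i' \in [:: ordS i; ord_pred i] ->
          j' \in [:: iter k (@ordS n) j; iter k (@ord_pred n) j] ->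
          peak_state_transfer R ((i, j) : vertex 4 n) (i', j') k].
Proof.
split; last first.
  move=> i j; split=> [on i'|m nE i'|k nE i' j']; first exact: peak_odd.
    exact: peak_half.
  exact: peak_quarter.
pose i : 'I_4 := ord0; pose j := Ordinal hn.
have adj : ordS i \in [:: ordS i; ord_pred i] by rewrite inE eqxx.
have [on|en] := boolP (odd n).
  by exists (i, j), (ordS i, j), n; exact: peak_odd.
exists (i, j), (ordS i, iter n./2 (@ordS n) j), n./2; apply: peak_half => //.
by rewrite mul2n even_halfK.
Qed.
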